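(* Let $d\ge 2$, $c>0$ and $A>0$. There exists a constant $C>0$, depending only on $d$, $c$ and $A$, such that for every odd prime power $q$ and every set $E\subset\mathbb{F}_q^d$ with $\#E\ge c\,q^{d/2}$ that is a Salem set with constant $A$, i.e. $$|\widehat{E}(m)|\le A\,q^{-d}\sqrt{\#E}\qquad\text{for every non-zero } m\in\mathbb{F}_q^d,$$ one has $$\#\Delta(E)\ge C\,q .$$
   Context: $\mathbb{F}_q$ is the finite field with $q$ elements. For $x\in\mathbb{F}_q^d$, $|x|^2=x_1^2+\dots+x_d^2\in\mathbb{F}_q$, and $\Delta(E)=\{|x-y|^2: x,y\in E\}\subset\mathbb{F}_q$. Fix a nontrivial additive character $\chi$ of $\mathbb{F}_q$ (for $q$ prime, $\chi(t)=e^{2\pi i t/q}$). Then $\widehat{E}(m)=q^{-d}\sum_{x\in E}\chi(-x\cdot m)$ for $m\in\mathbb{F}_q^d$, where $x\cdot m=\sum_j x_jm_j$, is the Fourier transform of the characteristic function of $E$. *)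

(* Defs.v *)
From HB Require Import structures.
From mathcomp Require Import all_boot all_order all_algebra.
From mathcomp Require Import complex.
From mathcomp Require Import reals exp.

Set Implicit Arguments.
Unset Strict Implicit.
Unset Printing Implicit Defensive.

Import Order.TTheory GRing.Theory Num.Theory.

Local Open Scope ring_scope.

Definition dotv (F : finFieldType) (d : nat) (x m : 'rV[F]_d) : F :=
  \sum_(j < d) x 0 j * m 0 j.

Definition normsq (F : finFieldType) (d : nat) (x : 'rV[F]_d) : F :=
  \sum_(j < d) x 0 j ^+ 2.

Definition distance_set (F : finFieldType) (d : nat) (E : {set 'rV[F]_d}) :
    {set F} :=
  [set normsq (x - y) | x in E, y in E].

(* A homomorphism from (F, +) to the multiplicative group of nonzero complex
   numbers; since F is finite its values automatically have modulus 1. *)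
Definition additive_character (R : realType) (F : finFieldType)
    (chi : F -> R[i]) : Prop :=
  chi 0 = 1 /\ {morph chi : s t / s + t >-> s * t}.

Definition nontrivial_additive_character (R : realType) (F : finFieldType)
    (chi : F -> R[i]) : Prop :=
  additive_character chi /\ exists t : F, chi t != 1.

Definition fourier (R : realType) (F : finFieldType) (d : nat)
    (chi : F -> R[i]) (E : {set 'rV[F]_d}) (m : 'rV[F]_d) : R[i] :=
  (#|F|%:R ^+ d)^-1 * \sum_(x in E) chi (- dotv x m).

(* The norm of R[i] takes its values in R[i], hence the embedding %:C of the
   real bound. *)
Definition salem (R : realType) (F : finFieldType) (d : nat)
    (chi : F -> R[i]) (A : R) (E : {set 'rV[F]_d}) : Prop :=
  forall m : 'rV[F]_d, m != 0 ->
    `|fourier chi E m|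
      <= (A * (#|F|%:R ^+ d)^-1 * Num.sqrt #|E|%:R)%:C%C.

(* Main.v *)
Require Import Defs.
From HB Require Import structures.
From mathcomp Require Import all_boot all_order all_algebra.
From mathcomp Require Import fingroup finalg cyclic.
From mathcomp Require Import complex.
From mathcomp Require Import reals exp.
From mathcomp Require Import ring.

(** Write q for the size of F, n for the size of E, and nu(t) for the number of
    pairs in E x E at distance t ([distance_count]).  Since nu is supported on
    the distance set and has total mass n^2, Cauchy-Schwarz gives
    n^4 <= #Delta(E) * sum_t nu(t)^2 ([card_pow4_le_distance_energy]), so it
    suffices to bound the energy sum_t nu(t)^2 by a constant times n^4 / q.

    By Parseval on F, q * sum_t nu(t)^2 = sum_s |T(s)|^2, where T(s) is the sum
    of chi(s |x - y|^2) over pairs in E x E.  The frequency s = 0 contributes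
    n^4.  For s = -1/(4r) with r nonzero, completing the square turns T into a
    quadratic exponential sum in frequency space
    ([gauss_sum_mul_distance_sum]):
      G(r) T(-1/(4r)) = Q(r) := sum_m |S(m)|^2 chi(r |m|^2),
    where S(m) = sum_{x in E} chi(-x.m), and the Gauss sum G(r) satisfies
    |G(r)|^2 = q^d.  Since r |-> -1/(4r) permutes the nonzero elements,
    q^d sum_{s <> 0} |T(s)|^2 <= sum_r |Q(r)|^2.

    Parseval on F again: sum_r |Q(r)|^2 = q sum_t P(t)^2, where P(t) is the
    mass of |S|^2 on the sphere |m|^2 = t.  The point m = 0 has mass n^2.  The
    rest of P(t) is at most A^2 n times the size of a sphere, that is
    2 A^2 n q^(d-1), by the Salem hypothesis; summed over t it is at most
    n q^d, by Plancherel.  Hence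
      q sum_t nu(t)^2 <= 3 n^4 + 4 A^2 n^2 q^d   ([distance_energy_le]),
    and n^2 >= c^2 q^d makes the last term O(n^4).

    Working with the energy, rather than with a lower bound for each nu(t), is
    what allows E to be as small as q^(d/2): bounding the Fourier transform of
    each individual sphere would require n >> q^((d+1)/2). *)

Set Implicit Arguments.
Unset Strict Implicit.
Unset Printing Implicit Defensive.

Import Order.TTheory GRing.Theory Num.Theory.

Local Open Scope ring_scope.

(** * Characters of finite abelian groups *)

Lemma mulrn_card (V : finZmodType) (v : V) : v *+ #|V| = 0.
Proof. by rewrite -FinRing.zmodXgE -cardsT expg_cardG ?inE. Qed.

(** If 2 = 0 then an odd multiple of 1 is 1, whereas #|F| times 1 is 0. *)
Lemma odd_card_two_neq0 (F : finFieldType) : odd #|F| -> 2%:R != 0 :> F.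
Proof.
move=> oddF; apply: contraNneq (oner_neq0 F) => two0.
rewrite -(mulrn_card (1 : F)) -(odd_double_half #|F|) oddF -muln2 natrD natrM.
by rewrite two0 mulr0 addr0.
Qed.

Section AdditiveCharacter.
Context (C : numClosedFieldType) (V : finZmodType) (psi : V -> C).
Context (psi0 : psi 0 = 1) (psiD : {morph psi : s t / s + t >-> s * t}).

(** The values are #|V|-th roots of unity. *)
Lemma norm_character v : `|psi v| = 1.
Proof.
have psiX n : psi (v *+ n) = psi v ^+ n.
  by elim: n => [|n IHn]; rewrite ?mulr0n // mulrS psiD IHn exprS.
have cardV : (0 < #|V|)%N by apply/card_gt0P; exists 0.
have := psiX #|V|; rewrite mulrn_card psi0 => /(congr1 Num.norm).
rewrite normr1 normrX => /esym/eqP.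
by rewrite pexpr_eq1 // => /eqP.
Qed.

Lemma conj_character v : (psi v)^* = psi (- v).
Proof.
have psi_neq0 : psi v != 0 by rewrite -normr_eq0 norm_character oner_eq0.
apply: (mulfI psi_neq0).
by rewrite -normCK norm_character expr1n -psiD subrr psi0.
Qed.

(** Translating the summation variable by [u] multiplies the sum by [psi u]. *)
Lemma sum_character_eq0 u : psi u != 1 -> \sum_v psi v = 0.
Proof.
move=> psi_u; set S := \sum_v psi v.
have shiftS : psi u * S = S.
  rewrite {2}/S (reindex_inj (addrI u)) /= /S mulr_sumr.
  by apply: eq_bigr => v _; rewrite psiD.
apply/eqP; move/eqP: shiftS.
by rewrite -{2}[S]mul1r -subr_eq0 -mulrBl mulf_eq0 subr_eq0 (negbTE psi_u).
Qed.

End AdditiveCharacter.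

(** * Dot product, spheres and distances *)

Section DotProduct.
Context (F : finFieldType) (d : nat).
Implicit Types x y v w : 'rV[F]_d.

Lemma dotvDl x y v : dotv (x + y) v = dotv x v + dotv y v.
Proof.
by rewrite /dotv -big_split; apply: eq_bigr => j _; rewrite mxE mulrDl.
Qed.

Lemma dotvDr x y v : dotv v (x + y) = dotv v x + dotv v y.
Proof.
by rewrite /dotv -big_split; apply: eq_bigr => j _; rewrite mxE mulrDr.
Qed.

Lemma dotvZl a x v : dotv (a *: x) v = a * dotv x v.
Proof. by rewrite /dotv mulr_sumr; apply: eq_bigr => j _; rewrite mxE mulrA. Qed.

Lemma dotvNl x v : dotv (- x) v = - dotv x v.
Proof. by rewrite -scaleN1r dotvZl mulN1r. Qed.

Lemma dotv0l v : dotv 0 v = 0.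
Proof. by rewrite -(scale0r v) dotvZl mul0r. Qed.

Lemma dotv0r v : dotv v 0 = 0.
Proof. by rewrite /dotv big1 // => j _; rewrite mxE mulr0. Qed.

Lemma dotvC x v : dotv x v = dotv v x.
Proof. by apply: eq_bigr => j _; rewrite mulrC. Qed.

Lemma normsqD x y : normsq (x + y) = normsq x + dotv x y *+ 2 + normsq y.
Proof.
rewrite /normsq /dotv -sumrMnl -!big_split; apply: eq_bigr => j _ /=.
by rewrite mxE sqrrD.
Qed.

Lemma normsqZ a x : normsq (a *: x) = a ^+ 2 * normsq x.
Proof.
by rewrite /normsq mulr_sumr; apply: eq_bigr => j _; rewrite mxE exprMn.
Qed.

Lemma normsq0 : normsq (0 : 'rV[F]_d) = 0.
Proof. by rewrite -[0](scale0r 0) normsqZ expr0n mul0r. Qed.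

Lemma dotv_nondegenerate x t : x != 0 -> exists v, dotv x v = t.
Proof.
case/matrix0Pn=> i [j]; rewrite ord1 => xj0.
exists (\row_k (if k == j then t / x 0 j else 0)).
rewrite /dotv (bigD1 j) //= big1 => [|k /negbTE kj]; rewrite mxE ?kj ?mulr0 //.
by rewrite eqxx addr0 mulrC divfK.
Qed.

End DotProduct.

(** A point of the sphere is determined by its last [d] coordinates and by
    which of the at most two square roots its first coordinate is. *)
Lemma card_sphere_le (F : finFieldType) (d : nat) (t : F) :
  (#|[set m : 'rV[F]_d.+1 | normsq m == t]| <= 2 * #|F| ^ d)%N.
Proof.
pose S := [set m : 'rV[F]_d.+1 | normsq m == t].
pose tailv (m : 'rV[F]_d.+1) : 'rV[F]_d := \row_j m 0 (lift ord0 j).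
have normsq_split (m : 'rV[F]_d.+1) : normsq m = m 0 ord0 ^+ 2 + normsq (tailv m).
  rewrite /normsq big_ord_recl; congr (_ + _).
  by apply: eq_bigr => j _; rewrite mxE.
(* The default 0 is never used on the tail of a point of the sphere. *)
pose root_of (u : 'rV[F]_d) := odflt 0 [pick a : F | a ^+ 2 == t - normsq u].
pose f (m : 'rV[F]_d.+1) := (m 0 ord0 == root_of (tailv m), tailv m).
have head_sq (m : 'rV[F]_d.+1) : m \in S -> m 0 ord0 ^+ 2 = root_of (tailv m) ^+ 2.
  rewrite inE normsq_split /root_of => /eqP <-; rewrite addrK.
  by case: pickP => [a /eqP -> //|/(_ (m 0 ord0))]; rewrite eqxx.
have f_inj : {in S &, injective f}.
  move=> m m' Sm Sm' [] ; move: (head_sq m Sm) (head_sq m' Sm') => /eqP + /eqP.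
  rewrite !eqf_sqr => + + + eq_tail; rewrite -eq_tail => hm hm' heq.
  have eq_head : m 0 ord0 = m' 0 ord0.
    move: hm hm' heq; case: (m 0 ord0 =P _) => [-> _ _ /esym/eqP -> //|_ /eqP ->].
    by case: (m' 0 ord0 =P _) => // _ /eqP ->.
  apply/rowP => j; case: (unliftP ord0 j) => [k|] -> //.
  by have /rowP/(_ k) := eq_tail; rewrite !mxE.
rewrite -(card_in_imset f_inj); apply: leq_trans (max_card _) _.
by rewrite card_prod card_bool card_mx mul1n.
Qed.

Definition distance_count (F : finFieldType) (d : nat) (E : {set 'rV[F]_d})
    (t : F) : nat :=
  #|[set p in setX E E | normsq (p.1 - p.2) == t]|.

(** Cauchy-Schwarz against the constant 1, summing 2ab <= a^2 + b^2 over all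
    pairs of terms. *)
Lemma sum_nat_sqr_le (I : finType) (A : {set I}) (a : I -> nat) :
  ((\sum_(i in A) a i) ^ 2 <= #|A| * \sum_(i in A) a i ^ 2)%N.
Proof.
rewrite -(leq_pmul2l (isT : 0 < 2)%N) expnS expn1 big_distrlr big_distrr /=.
have -> : (2 * (#|A| * \sum_(i in A) a i ^ 2) =
    \sum_(i in A) \sum_(j in A) (a i ^ 2 + a j ^ 2))%N.
  under [RHS]eq_bigr do rewrite big_split sum_nat_const /=.
  by rewrite big_split sum_nat_const -big_distrr /= addnn mul2n.
apply: leq_sum => i _; rewrite big_distrr /=; apply: leq_sum => j _.
exact: nat_Cauchy.
Qed.

(** The counts of the pairs at each distance sum to the number #|E|^2 of all
    pairs, and only distances in the distance set occur; apply
    Cauchy-Schwarz. *)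
Lemma card_pow4_le_distance_energy (F : finFieldType) (d : nat)
    (E : {set 'rV[F]_d}) :
  (#|E| ^ 4 <= #|distance_set E| * \sum_t distance_count E t ^ 2)%N.
Proof.
have cardE2 : (#|E| ^ 2 = \sum_(t in distance_set E) distance_count E t)%N.
  rewrite -mulnn -cardsX -sum1_card.
  rewrite (partition_big (fun p => normsq (p.1 - p.2)) (mem (distance_set E))) /=.
    apply: eq_bigr => t _; rewrite /distance_count -sum1_card; apply: eq_bigl => p.
    by rewrite !inE.
  by case=> x y; rewrite inE => /andP[/= Ex Ey]; apply: imset2_f.
rewrite (expnM _ 2 2) cardE2; apply: leq_trans (sum_nat_sqr_le _ _) _.
rewrite leq_mul2l [X in (_ <= X)%N](bigID (mem (distance_set E))) /=.
by rewrite leq_addr orbT.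
Qed.

(** * Orthogonality, Parseval and Plancherel *)

Section FourierAnalysis.
Context (C : numClosedFieldType) (F : finFieldType) (chi : F -> C).
Context (chi0 : chi 0 = 1) (chiD : {morph chi : s t / s + t >-> s * t}).
Context (chi_nontriv : exists t, chi t != 1).

Lemma sum_chi_mul a : \sum_s chi (s * a) = (a == 0)%:R * #|F|%:R.
Proof.
case: eqVneq => [->|a0].
  by rewrite mul1r (eq_bigr (fun=> 1)) ?sumr_const // => s _; rewrite mulr0.
have [t chi_t] := chi_nontriv; rewrite mul0r.
apply: (@sum_character_eq0 _ _ (fun s => chi (s * a)) _ (t / a)).
  by move=> s s'; rewrite mulrDl chiD.
by rewrite divfK.
Qed.

Lemma sum_chi_dotv d (x : 'rV[F]_d) :
  \sum_m chi (dotv x m) = (x == 0)%:R * #|F|%:R ^+ d.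
Proof.
case: eqVneq => [->|x0].
  rewrite mul1r (eq_bigr (fun=> 1)) ?sumr_const ?card_mx ?mul1n ?natrX //.
  by move=> m _; rewrite dotv0l.
have [t chi_t] := chi_nontriv; rewrite mul0r.
have [v dot_v] := dotv_nondegenerate t x0.
apply: (@sum_character_eq0 _ _ (fun m => chi (dotv x m)) _ v).
  by move=> m m'; rewrite dotvDr chiD.
by rewrite dot_v.
Qed.

(** The parameter [v] lets the phases be presented as functions of the
    frequency over which both sides are summed afterwards. *)
Lemma sqr_norm_sum_character (V I : finType) (P : pred I) (w : I -> C)
    (e : I -> V -> F) v :
  `|\sum_(i | P i) w i * chi (e i v)| ^+ 2 =
  \sum_(i | P i) \sum_(j | P j) w i * (w j)^* * chi (e i v - e j v).
Proof.
rewrite normCK rmorph_sum big_distrlr.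
apply: eq_bigr => i _; apply: eq_bigr => j _.
by rewrite rmorphM /= conj_character // mulrACA -chiD.
Qed.

(** The inner sum on the left is the Fourier transform at [s] of the push-forward
    of the weight [w] to [F] along [phi], so this is Parseval on [F] for that
    push-forward.  It is used both in physical space, with the pairs of points of E
    and their distance, and in frequency space, with the frequencies and their
    norm. *)
Lemma parseval_level_sets (I : finType) (P : pred I) (w : I -> C)
    (phi : I -> F) :
  \sum_s `|\sum_(i | P i) w i * chi (s * phi i)| ^+ 2 =
  #|F|%:R * \sum_t `|\sum_(i | P i && (phi i == t)) w i| ^+ 2.
Proof.
under eq_bigr do rewrite (sqr_norm_sum_character P w (fun i s => s * phi i)).
have -> : \sum_t `|\sum_(i | P i && (phi i == t)) w i| ^+ 2 =
    \sum_(i | P i) \sum_(j | P j) w i * (w j)^* * (phi i == phi j)%:R.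
  rewrite [RHS](partition_big phi xpredT) //=; apply: eq_bigr => t _.
  rewrite normCK rmorph_sum big_distrlr; apply: eq_bigr => i /andP[_ /eqP <-].
  rewrite big_mkcondr; apply: eq_bigr => j _.
  by rewrite [phi j == _]eq_sym; case: eqP; rewrite ?mulr1 ?mulr0.
rewrite exchange_big mulr_sumr; apply: eq_bigr => i _.
rewrite exchange_big mulr_sumr; apply: eq_bigr => j _.
rewrite -mulr_sumr (eq_bigr (fun s => chi (s * (phi i - phi j)))); last first.
  by move=> s _; rewrite mulrBr.
by rewrite sum_chi_mul subr_eq0 mulrA mulrC.
Qed.

(** The Fourier transform of E without the factor q^(-d). *)
Definition exp_sum d (E : {set 'rV[F]_d}) (m : 'rV[F]_d) : C :=
  \sum_(x in E) chi (- dotv x m).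

Lemma sqr_norm_exp_sum d (E : {set 'rV[F]_d}) m :
  `|exp_sum E m| ^+ 2 = \sum_(x in E) \sum_(y in E) chi (dotv (x - y) m).
Proof.
rewrite /exp_sum (eq_bigr (fun x => 1 * chi (- dotv x m))) => [|x _]; last first.
  by rewrite mul1r.
rewrite (sqr_norm_sum_character _ (fun=> 1) (fun x m => - dotv x m)) exchange_big.
apply: eq_bigr => x _; apply: eq_bigr => y _.
by rewrite conjC1 !mul1r opprK dotvDl dotvNl addrC.
Qed.

Lemma plancherel_exp_sum d (E : {set 'rV[F]_d}) :
  \sum_m `|exp_sum E m| ^+ 2 = #|E|%:R * #|F|%:R ^+ d.
Proof.
under eq_bigr do rewrite sqr_norm_exp_sum.
rewrite exchange_big -[#|E|]sum1_card natr_sum mulr_suml; apply: eq_bigr => x Ex.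
rewrite exchange_big (bigD1 x) //= [X in _ + X]big1 => [|y /andP[_ xy]].
  by rewrite sum_chi_dotv subrr eqxx addr0.
by rewrite sum_chi_dotv subr_eq0 eq_sym (negbTE xy) mul0r.
Qed.

(** * Gauss sums *)

Context (two_neq0 : 2%:R != 0 :> F).

Definition gauss_sum d (r : F) : C := \sum_(v : 'rV[F]_d) chi (r * normsq v).

(** Expand the square over pairs (w + h, w): the exponent becomes
    r |h|^2 + 2 r h.w, linear in w, and summing over w leaves only h = 0. *)
Lemma sqr_norm_gauss_sum d (r : F) : r != 0 -> `|gauss_sum d r| ^+ 2 = #|F|%:R ^+ d.
Proof.
move=> r0; rewrite /gauss_sum.
rewrite (eq_bigr (fun v => 1 * chi (r * normsq v))) => [|x _]; last first.
  by rewrite mul1r.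
rewrite (sqr_norm_sum_character _ (fun=> 1) (fun v s => s * normsq v)).
rewrite exchange_big; transitivity (\sum_(h : 'rV[F]_d) \sum_w
    chi (r * normsq h) * chi (dotv ((2%:R * r) *: h) w)).
  rewrite [RHS]exchange_big; apply: eq_bigr => w _.
  rewrite (reindex_inj (addIr w)); apply: eq_bigr => h _ /=.
  rewrite conjC1 !mul1r -chiD normsqD dotvZl; congr chi; ring.
rewrite (bigD1 0) //= [X in _ + X]big1 => [|h h0]; rewrite -mulr_sumr sum_chi_dotv.
  by rewrite normsq0 mulr0 chi0 scaler0 eqxx !mul1r addr0.
by rewrite scaler_eq0 (negbTE h0) !mulf_eq0 (negbTE r0) (negbTE two_neq0) mul0r mulr0.
Qed.

(** Substitute m - v/(2r) for m: the quadratic phase has an explicit Fourier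
    transform. *)
Lemma gauss_sum_complete_square d (r : F) (v : 'rV[F]_d) : r != 0 ->
  \sum_m chi (r * normsq m) * chi (dotv v m) =
  chi (- (4%:R * r)^-1 * normsq v) * gauss_sum d r.
Proof.
move=> r0; rewrite (reindex_inj (addIr (- (2%:R * r)^-1 *: v))) mulr_sumr.
have four_neq0 : 4%:R != 0 :> F by rewrite (natrM _ 2 2) mulf_neq0.
apply: eq_bigr => m _ /=; rewrite -!chiD; congr chi.
rewrite normsqD normsqZ [dotv m _]dotvC dotvDr dotvZl.
rewrite [dotv v (_ *: _)]dotvC dotvZl.
have -> : dotv v v = normsq v by apply: eq_bigr => j _; rewrite expr2.
by field; apply/and3P; split.
Qed.

(** The duality on which the energy estimate rests: up to the factor of known
    modulus on the left, the sum of quadratic phases of the distances in E at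
    the frequency -1/(4r) is the spectral sum of quadratic phases at r. *)
Lemma gauss_sum_mul_distance_sum d (E : {set 'rV[F]_d}) (r : F) : r != 0 ->
  gauss_sum d r *
    \sum_(p in setX E E) chi (- (4%:R * r)^-1 * normsq (p.1 - p.2)) =
  \sum_m `|exp_sum E m| ^+ 2 * chi (r * normsq m).
Proof.
move=> r0.
under [RHS]eq_bigr do rewrite sqr_norm_exp_sum pair_big_dep mulr_suml.
rewrite exchange_big mulr_sumr.
apply: eq_big => [p|p _] /=; first by rewrite inE.
rewrite mulrC -gauss_sum_complete_square //.
by apply: eq_bigr => m _; rewrite mulrC.
Qed.

(** * The distance energy *)

(** Apart from the mass n^2 at the origin, the mass of |S|^2 on each sphere is
    bounded by [B] times the size of the sphere, and the sum of these masses is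
    controlled by Plancherel; the sum of squares is at most the product of the
    maximum and the sum. *)
Lemma sum_sqr_spectrum_level_le d (E : {set 'rV[F]_d.+1}) (B : C) : 0 <= B ->
    (forall m : 'rV[F]_d.+1, m != 0 -> `|exp_sum E m| ^+ 2 <= B) ->
  \sum_t (\sum_(m | normsq m == t) `|exp_sum E m| ^+ 2) ^+ 2 <=
  2%:R * #|E|%:R ^+ 4 + 4%:R * B * #|E|%:R * #|F|%:R ^+ d * #|F|%:R ^+ d.+1.
Proof.
move=> B0 flat.
pose M t := \sum_(m | (normsq m == t) && (m != 0)) `|exp_sum E m| ^+ 2.
have M0 t : 0 <= M t by apply: sumr_ge0 => m _; rewrite exprn_ge0.
have E0 : `|exp_sum E 0| ^+ 2 = #|E|%:R ^+ 2.
  rewrite /exp_sum (eq_bigr (fun=> 1)) => [|x _]; last by rewrite dotv0r oppr0.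
  by rewrite sumr_const normr_nat.
have levelE t : \sum_(m | normsq m == t) `|exp_sum E m| ^+ 2 =
    (t == 0)%:R * #|E|%:R ^+ 2 + M t.
  case: eqVneq => [->|t0]; last first.
    rewrite mul0r add0r; apply: eq_bigl => m.
    case: (m =P 0) => [->|_]; last by rewrite andbT.
    by rewrite normsq0 andbF eq_sym (negbTE t0).
  by rewrite (bigD1 0) ?normsq0 //= E0 mul1r.
have Mle t : M t <= 2%:R * B * #|F|%:R ^+ d.
  apply: le_trans (_ : \sum_(m | normsq m == t) B <= _).
    rewrite /M big_mkcondr; apply: ler_sum => m _.
    by case: ifP => // /flat.
  rewrite sumr_const -[X in X <= _]mulr_natr [_ * B]mulrC -mulrA ler_wpM2l //.
  rewrite -natrX -natrM ler_nat.
  by apply: leq_trans (card_sphere_le d t); rewrite cardsE.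
have sumM : \sum_t M t <= #|E|%:R * #|F|%:R ^+ d.+1.
  have -> : \sum_t M t = \sum_(m | m != 0) `|exp_sum E m| ^+ 2.
    rewrite [RHS](partition_big (fun m => normsq m) xpredT) //=.
    by apply: eq_bigr => t _; apply: eq_bigl => m; rewrite andbC.
  rewrite -plancherel_exp_sum [X in X <= _]big_mkcond ler_sum // => m _.
  by case: ifP => // _; rewrite exprn_ge0.
apply: le_trans (_ : \sum_t (2%:R * ((t == 0)%:R * #|E|%:R ^+ 4) +
    2%:R * (2%:R * B * #|F|%:R ^+ d * M t)) <= _).
  apply: ler_sum => t _; rewrite levelE.
  apply: le_trans
    (_ : 2%:R * ((t == 0)%:R * #|E|%:R ^+ 4) + 2%:R * (M t * M t) <= _).
    have -> : (t == 0)%:R * #|E|%:R ^+ 4 =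
        ((t == 0)%:R * #|E|%:R ^+ 2) ^+ 2 :> C.
      by case: (t == 0); rewrite ?mul1r ?mul0r ?expr0n // -exprM.
    (* (a + M)^2 <= 2 a^2 + 2 M^2, where a is the mass at the origin *)
    set a := _ * _ ^+ 2; rewrite -subr_ge0.
    have -> : 2%:R * a ^+ 2 + 2%:R * (M t * M t) - (a + M t) ^+ 2 =
      (a - M t) ^+ 2 by ring.
    rewrite real_exprn_even_ge0 // rpredB // ?ger0_real // /a.
    by rewrite mulr_ge0 ?exprn_ge0 ?ler0n.
  by rewrite lerD2l ler_wpM2l // ler_wpM2r.
rewrite big_split /= -!mulr_sumr -mulr_suml (bigD1 0) //= eqxx.
rewrite [X in 1 + X]big1 => [|t /negbTE -> //]; rewrite addr0 mul1r lerD2l.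
have -> : 4%:R * B * #|E|%:R * #|F|%:R ^+ d * #|F|%:R ^+ d.+1 =
    2%:R * (2%:R * B * #|F|%:R ^+ d * (#|E|%:R * #|F|%:R ^+ d.+1)) :> C by ring.
by rewrite ler_wpM2l // ler_wpM2l // !mulr_ge0 ?exprn_ge0 ?ler0n.
Qed.

(** Parseval passes from the counts to T, the Gauss sum duality from T to Q, and
    Parseval again from Q to the masses of the spheres.  The 3 is one n^4 from
    the frequency 0 of T and two from the mass of |S|^2 at the origin. *)
Lemma distance_energy_le d (E : {set 'rV[F]_d}) (B : C) :
    (2 <= d)%N -> 0 <= B ->
    (forall m : 'rV[F]_d, m != 0 -> `|exp_sum E m| ^+ 2 <= B) ->
  #|F|%:R * (\sum_t distance_count E t ^ 2)%:R <=
  3%:R * #|E|%:R ^+ 4 + 4%:R * B * #|E|%:R * #|F|%:R ^+ d.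
Proof.
move=> d2 B0 flat.
have q_gt0 : 0 < #|F|%:R :> C by rewrite ltr0n; apply/card_gt0P; exists 0.
pose T (s : F) := \sum_(p in setX E E) chi (s * normsq (p.1 - p.2)).
pose Q (r : F) := \sum_m `|exp_sum E m| ^+ 2 * chi (r * normsq m).
have energyE : #|F|%:R * (\sum_t distance_count E t ^ 2)%:R = \sum_s `|T s| ^+ 2.
  transitivity (\sum_s
      `|\sum_(p in setX E E) 1 * chi (s * normsq (p.1 - p.2))| ^+ 2); last first.
    apply: eq_bigr => s _; congr (`|_| ^+ 2).
    by apply: eq_bigr => p _; rewrite mul1r.
  rewrite (parseval_level_sets _ (fun=> 1)) natr_sum; congr (_ * _).
  apply: eq_bigr => t _; rewrite natrX sumr_const normr_nat /distance_count.
  by congr (_%:R ^+ 2); apply: eq_card => p; rewrite inE.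
have T0 : `|T 0| ^+ 2 = #|E|%:R ^+ 4.
  rewrite /T (eq_bigr (fun=> 1)) => [|p _]; last by rewrite mul0r.
  by rewrite sumr_const cardsX normr_nat natrM -expr2 -exprM.
have sumQ : \sum_r `|Q r| ^+ 2 <=
    #|F|%:R * (2%:R * #|E|%:R ^+ 4 +
      4%:R * B * #|E|%:R * #|F|%:R ^+ d.-1 * #|F|%:R ^+ d).
  rewrite parseval_level_sets ler_wpM2l ?(ltW q_gt0) //.
  case: d d2 E flat {T Q energyE T0} => // d _ E flat.
  apply: le_trans (sum_sqr_spectrum_level_le B0 flat).
  apply: ler_sum => t _; rewrite ger0_norm //.
  by apply: sumr_ge0 => m _; rewrite exprn_ge0.
have four_neq0 : 4%:R != 0 :> F by rewrite (natrM _ 2 2) mulf_neq0.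
(* As 0^-1 = 0, the map r |-> -1/(4r) permutes all of F and fixes 0. *)
have dualK : involutive (fun r : F => - (4%:R * r)^-1).
  move=> r; have [->|r0] := eqVneq r 0; first by rewrite !(mulr0, invr0, oppr0).
  by field; rewrite r0 four_neq0 oppr_eq0 oner_eq0.
have sumT : #|F|%:R ^+ d * \sum_(s | s != 0) `|T s| ^+ 2 <= \sum_r `|Q r| ^+ 2.
  rewrite (reindex_inj (inv_inj dualK)) mulr_sumr [X in X <= _]big_mkcond.
  apply: ler_sum => r _ /=; rewrite oppr_eq0 invr_eq0 mulf_eq0 (negbTE four_neq0).
  have [_|r0] := eqVneq r 0; first by rewrite exprn_ge0.
  by rewrite -(sqr_norm_gauss_sum d r0) -exprMn -normrM gauss_sum_mul_distance_sum.
have qd_gt0 : 0 < #|F|%:R ^+ d :> C by rewrite exprn_gt0.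
rewrite -(ler_pM2l qd_gt0) energyE (bigD1 0) //= T0 mulrDr.
apply: le_trans (lerD (lexx _) (le_trans sumT sumQ)) _.
(* Both sides are brought to a form whose difference is 2 n^4 (q^d - q). *)
have -> : #|F|%:R ^+ d *
     (3%:R * #|E|%:R ^+ 4 + 4%:R * B * #|E|%:R * #|F|%:R ^+ d) =
   #|F|%:R ^+ d * #|E|%:R ^+ 4 + (2%:R * #|E|%:R ^+ 4 * #|F|%:R ^+ d +
     4%:R * B * #|E|%:R * (#|F|%:R * #|F|%:R ^+ d.-1) * #|F|%:R ^+ d) :> C.
  by rewrite -exprS prednK ?(ltnW d2) //; ring.
have -> : #|F|%:R * (2%:R * #|E|%:R ^+ 4 +
     4%:R * B * #|E|%:R * #|F|%:R ^+ d.-1 * #|F|%:R ^+ d) =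
   2%:R * #|E|%:R ^+ 4 * #|F|%:R +
     4%:R * B * #|E|%:R * (#|F|%:R * #|F|%:R ^+ d.-1) * #|F|%:R ^+ d :> C.
  by ring.
rewrite lerD2l lerD2r ler_wpM2l ?mulr_ge0 ?exprn_ge0 ?ler0n //.
rewrite -{1}[#|F|%:R]expr1 ler_weXn2l ?(ltnW d2) // ler1n.
by apply/card_gt0P; exists 0.
Qed.

End FourierAnalysis.

(** * Distance sets of Salem sets *)

Theorem theorem1p6 (R : realType) (d : nat) (c A : R)
    (hd : (2 <= d)%N) (hc : 0 < c) (hA : 0 < A) :
  exists C : R, 0 < C /\
    forall (F : finFieldType), odd #|F| ->
    forall (chi : F -> R[i]), nontrivial_additive_character chi ->
    forall (E : {set 'rV[F]_d}),
      c * (#|F|%:R `^ (d%:R / 2)) <= #|E|%:R ->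
      salem chi A E ->
      C * #|F|%:R <= #|distance_set E|%:R.
Proof.
(* The energy bound with B = A^2 n, after q^d <= n^2 / c^2. *)
pose K := 3 + 4 * A ^+ 2 / c ^+ 2.
have K_gt0 : 0 < K by rewrite addr_gt0 ?divr_gt0 ?mulr_gt0 ?exprn_gt0.
exists K^-1; split=> [|F oddF chi [[chi0 chiD] chi_nontriv] E largeE salemE].
  by rewrite invr_gt0.
have q_gt0 : 0 < #|F|%:R :> R by rewrite ltr0n; apply/card_gt0P; exists 0.
have n_gt0 : 0 < #|E|%:R :> R.
  by apply: lt_le_trans largeE; rewrite mulr_gt0 ?powR_gt0.
have sqr_largeE : c ^+ 2 * #|F|%:R ^+ d <= #|E|%:R ^+ 2.
  have -> : #|F|%:R ^+ d = (#|F|%:R `^ (d%:R / 2)) ^+ 2 :> R.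
    rewrite -[RHS]powR_mulrn ?powR_ge0 // -powRrM divfK ?pnatr_eq0 //.
    by rewrite powR_mulrn // ltW.
  by rewrite -exprMn lerXn2r // nnegrE ?mulr_ge0 ?powR_ge0 // ltW.
have flat (m : 'rV[F]_d) : m != 0 ->
    `|exp_sum chi E m| ^+ 2 <= (A ^+ 2 * #|E|%:R)%:C%C.
  move=> /salemE; rewrite /fourier -/(exp_sum chi E m).
  rewrite normrM normfV normrX normr_nat.
  rewrite [A * _]mulrC -mulrA rmorphM rmorphV ?unitfE ?expf_neq0 ?lt0r_neq0 //.
  rewrite rmorphXn rmorph_nat ler_pM2l ?invr_gt0 ?exprn_gt0 ?ltr0n -?(ltr0n R) //.
  move=> le_exp_sum; have -> : A ^+ 2 * #|E|%:R = (A * Num.sqrt #|E|%:R) ^+ 2.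
    by rewrite exprMn sqr_sqrtr ?ler0n.
  by rewrite rmorphXn lerXn2r // nnegrE ler0c mulr_ge0 ?sqrtr_ge0 // ltW.
have := distance_energy_le chi0 chiD chi_nontriv (odd_card_two_neq0 oddF)
  hd _ flat.
rewrite ler0c mulr_ge0 ?exprn_ge0 ?(ltW hA) // => /(_ isT).
rewrite -!(rmorph_nat (real_complex R)) -!(rmorphXn (real_complex R)).
rewrite -!(rmorphM (real_complex R)) -rmorphD /= lecR => energy.
have energy_le :
    #|F|%:R * (\sum_t distance_count E t ^ 2)%:R <= K * #|E|%:R ^+ 4.
  apply: le_trans energy _; rewrite [K * _]mulrDl lerD2l.
  have -> : 4 * (A ^+ 2 * #|E|%:R) * #|E|%:R * #|F|%:R ^+ d =
      4 * A ^+ 2 / c ^+ 2 * (#|E|%:R ^+ 2 * (c ^+ 2 * #|F|%:R ^+ d)).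
    by field; apply: lt0r_neq0.
  have -> : #|E|%:R ^+ 4 = #|E|%:R ^+ 2 * #|E|%:R ^+ 2 :> R by ring.
  by rewrite !ler_wpM2l // ?divr_ge0 ?mulr_ge0 ?exprn_ge0 // ltW.
have cs : #|E|%:R ^+ 4 <=
    #|distance_set E|%:R * (\sum_t distance_count E t ^ 2)%:R :> R.
  by rewrite -natrX -natrM ler_nat card_pow4_le_distance_energy.
rewrite ler_pdivrMl // -(ler_pM2r (exprn_gt0 4 n_gt0)).
apply: le_trans (ler_wpM2l (ltW q_gt0) cs) _.
by rewrite mulrCA -mulrA [X in _ <= X]mulrCA ler_wpM2l.
Qed.
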